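(* Let $(a_i)_{i\ge0}\in\ell^1$ be a sequence of positive real numbers, let $M\ge0$ be an integer, put $a_j=0$ for $j<0$, and let $\mathfrak H=(\mathfrak H_{i,j})_{i,j\in\mathbb N}$ be the infinite Hessenberg matrix with $\mathfrak H_{0,j}=a_{j-M}$ for $j\ge0$ and $\mathfrak H_{i,j}=a_{j-i+1}$ for $i\ge1$, $j\ge0$, i.e. $$\mathfrak H=\begin{pmatrix} a_{0-M}&a_{1-M}&a_{2-M}&a_{3-M}&\cdots\\ a_0&a_1&a_2&a_3&\cdots\\ 0&a_0&a_1&a_2&\cdots\\ 0&0&a_0&a_1&\cdots\\ \vdots&\vdots&\ddots&\ddots&\ddots\end{pmatrix}.$$ Then its spectral radius $\rho_{\mathfrak H}$ satisfies $$\log\rho_{\mathfrak H}=\inf_{q\le0}\log\Big(\sum_{k\in\mathbb N}a_k e^{q(k-1)}\Big).$$ Moreover, $\log\rho_{\mathfrak H}=\log\big(\sum_{k\in\mathbb N}a_k\big)$ if $\sum_{k\in\mathbb N}(k-1)a_ke^{qk}<0$ for all $q\le0$; and $\log\rho_{\mathfrak H}=\log\big(\sum_{k\in\mathbb N}a_ke^{q_0(k-1)}\big)$ if there exists a unique $q_0<0$ with $\sum_{k\in\mathbb N}(k-1)a_ke^{q_0k}=0$.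
   Context: $\mathbb N=\{0,1,2,\dots\}$. The spectral radius of $\mathfrak H$ is $\rho_{\mathfrak H}=\limsup_{n\to\infty}\big((\mathfrak H^n)_{i,i}\big)^{1/n}$, which by irreducibility does not depend on $i\in\mathbb N$. *)

(* Defs.v *)
From mathcomp Require Export all_boot all_order all_algebra.
From mathcomp Require Export all_classical all_reals all_analysis.

Set Implicit Arguments.
Unset Strict Implicit.
Unset Printing Implicit Defensive.

Import Order.TTheory GRing.Theory Num.Theory.
Local Open Scope ring_scope.
Local Open Scope ereal_scope.

(* Entries and their infinite sums are taken in \bar R, so that products of
   matrices with nonnegative entries need no convergence hypothesis. *)
Definition imatrix (R : realType) := nat -> nat -> \bar R.

Definition imx_id (R : realType) : imatrix R :=
  fun i j => (i == j)%:R%:E.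

Definition imx_mul (R : realType) (A B : imatrix R) : imatrix R :=
  fun i j => \sum_(0 <= k <oo) (A i k * B k j).

Definition imx_pow (R : realType) (A : imatrix R) (n : nat) : imatrix R :=
  iter n (imx_mul A) (imx_id R).

(* The exponent at n = 0 is 0^-1 = 0, which does not affect the limsup; for
   n > 0 a zero diagonal entry contributes 0 `^ n^-1 = 0. *)
Definition spectral_radius_at (R : realType) (A : imatrix R) (i : nat) :
    \bar R :=
  limn_esup (fun n => imx_pow A n i i `^ (n%:R^-1)%R).

Definition zero_ext (R : realType) (a : nat -> R) (j : int) : R :=
  match j with
  | Posz n => a n
  | Negz _ => 0%R
  end.

Definition hessenberg (R : realType) (a : nat -> R) (M : nat) : imatrix R :=
  fun i j =>
    (if i == 0%N then zero_ext a (j%:Z - M%:Z)%R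
     else zero_ext a (j%:Z - i%:Z + 1)%R)%:E.

(* Main.v *)
Require Import Defs.
From mathcomp Require Import ring lra.
Import Order.TTheory GRing.Theory Num.Theory.
Import numFieldNormedType.Exports.
Local Open Scope ring_scope.
Local Open Scope ereal_scope.
Local Open Scope classical_set_scope.

Set Implicit Arguments.
Unset Strict Implicit.
Unset Printing Implicit Defensive.

(** Write [S q] for the sum of the [a k * expR (q * (k - 1))].

    Upper bound: for [q <= 0] the vector [j |-> expR (q * j)] satisfies
    [H x <= S q * x], whence [(H ^ n) i i <= S q ^ n].

    Lower bound: if the spectral radius is less than [r], the Green function
    [g j], the sum over [n] of [(H ^ n) j i / r ^ n], is finite and positive and
    satisfies [H g <= r * g].  If [inf g > 0], rows [j] with [g j] close to the
    infimum show that [S 0 <= r].  Otherwise [g N <= 1] for arbitrarily large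
    [N]; averaging the inequalities [sum_k a k * g (j + k) / g (j + 1) <= r]
    over [j < N] and using Jensen's inequality gives [S q <= r] up to an error
    vanishing as [N] grows, where [q = ln (g N) / N <= 0] is the mean growth
    rate of [g].

    The last two claims follow from the convexity of [S]. *)

(** * Positive sequences superharmonic for the rows of the matrix *)

(** Induction on [k]: raising [k] by one adds [h (N + k) - h k] to the sum, and [h (N + k)] is at
    least [h N - k * C]. The point is that [D] depends on [k] but not on [N]. *)
Lemma shifted_increments_bounded_below (R : realType) (h : nat -> R) (C : R) :
  (forall j, h j - C <= h j.+1)%R ->
  forall k, exists D : R, forall N,
    (- D <= \sum_(0 <= j < N) (h (j + k)%N - h j.+1) - (k%:R - 1) * h N)%R.
Proof.
move=> hC; have hCk N k : (h N - k%:R * C <= h (N + k)%N)%R.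
  elim: k => [|k IH]; first by rewrite addn0; lra.
  by rewrite addnS; have := hC (N + k)%N; rewrite -natr1; lra.
elim=> [|k [D HD]].
  exists (- h 0%N)%R => N.
  rewrite (_ : (\sum_(0 <= j < N) _)%R = (h 0%N - h N)%R); first lra.
  elim: N => [|N IH]; first by rewrite big_nil; lra.
  by rewrite big_nat_recr //= IH addn0; lra.
exists (D + k%:R * C + h k)%R => N.
have -> : (\sum_(0 <= j < N) (h (j + k.+1)%N - h j.+1) =
    \sum_(0 <= j < N) (h (j + k)%N - h j.+1) + h (N + k)%N - h k)%R.
  elim: N => [|N IH]; first by rewrite !big_nil add0n; lra.
  by rewrite !big_nat_recr //= IH addSnnS; lra.
by have := HD N; have := hCk N k; rewrite -natr1; lra.
Qed.

Lemma superharmonic_eigenvalue_gt0 (R : realType) (a g : nat -> R) (r : R) :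
  (forall k, 0 < a k)%R -> (forall j, 0 < g j)%R ->
  (forall j K, \sum_(0 <= k < K) a k * g (j + k)%N <= r * g j.+1)%R ->
  (0 < r)%R.
Proof.
move=> a0 g0 rg; have := rg 0%N 1%N; rewrite big_nat1 add0n => h.
by rewrite -(pmulr_lgt0 _ (g0 1%N)); apply: lt_le_trans h; apply: mulr_gt0.
Qed.

Definition laplace_psum (R : realType) (a : nat -> R) (q : R) (K : nat) : R :=
  (\sum_(0 <= k < K) a k * expR (q * (k%:R - 1)))%R.

(* With [q] the mean logarithmic growth of [g] on [0, N], Jensen's inequality
   (through the tangent of [expR]) applied to the averages over [j < N] of
   [g (j + k) / g (j + 1)] replaces these ratios by [expR (q * (k - 1))]. *)
Lemma superharmonic_mean_growth (R : realType) (a g : nat -> R) (r : R)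
    (K : nat) :
  (forall k, 0 < a k)%R -> (forall j, 0 < g j)%R ->
  (forall j K, \sum_(0 <= k < K) a k * g (j + k)%N <= r * g j.+1)%R ->
  exists2 D : R, (0 <= D)%R & forall N, (0 < N)%N ->
    ((N%:R - D) * laplace_psum a (ln (g N) / N%:R) K <= r * N%:R)%R.
Proof.
move=> a0 g0 rg.
have r0 := superharmonic_eigenvalue_gt0 a0 g0 rg.
pose h j := ln (g j).
have gE j : g j = expR (h j) by rewrite lnK // posrE.
have [D D0 HD] : exists2 D : R, (0 <= D)%R & forall k N, (k < K)%N ->
    (- D <= \sum_(0 <= j < N) (h (j + k)%N - h j.+1) - (k%:R - 1) * h N)%R.
  (* The [k = 0] term of the row inequality alone gives [a 0 * g j <= r * g j.+1]. *)
  have hC j : (h j - ln (r / a 0%N) <= h j.+1)%R.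
    have := rg j 1%N; rewrite big_nat1 addn0 => H.
    rewrite lerBlDr -ler_expR expRD -!gE lnK ?posrE ?divr_gt0 //.
    by rewrite mulrA ler_pdivlMr // mulrC (mulrC (g _)).
  have /= H k := shifted_increments_bounded_below hC k.
  elim: K => [|K [D D0 HD]]; first by exists 0%R.
  have [D' HD'] := H K.
  exists (Num.max D D'); first by rewrite le_max D0.
  move=> k N; rewrite ltnS leq_eqVlt => /predU1P[->|kK].
    by apply: le_trans (HD' N); rewrite lerN2 le_max lexx orbT.
  by apply: le_trans (HD k N kK); rewrite lerN2 le_max lexx.
exists D => // N N0.
have N0R : (0 < N%:R :> R)%R by rewrite ltr0n.
have -> : (r * N%:R = \sum_(0 <= j < N) r)%R.
  by rewrite big_const_nat iter_addr_0 subn0 mulr_natr.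
apply: (@le_trans _ _ (\sum_(0 <= j < N) \sum_(0 <= k < K)
    a k * expR (h (j + k)%N - h j.+1))%R); last first.
  apply: ler_sum => j _; have := rg j K.
  rewrite -ler_pdivrMr // mulr_suml; apply: le_trans; apply: ler_sum => k _.
  by rewrite expRB -!gE mulrA.
rewrite exchange_big /= /laplace_psum mulr_sumr !big_nat.
apply: ler_sum => k /andP[_ kK].
rewrite mulrCA -mulr_sumr ler_pM2l //.
set c := (_ / _ * _)%R.
have cN : (c * N%:R = (k%:R - 1) * h N)%R.
  by rewrite /c mulrAC divfK ?gt_eqF // mulrC.
apply: (@le_trans _ _ (\sum_(0 <= j < N)
    expR c * (1 + (h (j + k)%N - h j.+1 - c)))%R); last first.
  apply: ler_sum => j _.
  rewrite -[X in (_ <= expR X)%R](subrKC c) expRD ler_pM2l ?expR_gt0 //.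
  exact: expR_ge1Dx.
(* The brackets add up to [N] plus the increments of [h] minus [(k - 1) * h N], hence to at least
   [N - D]. *)
rewrite -mulr_sumr mulrC ler_pM2l ?expR_gt0 //.
rewrite big_split sumrB /= !big_const_nat !iter_addr_0 subn0 -(mulr_natr c) cN.
by have := HD k N kK; lra.
Qed.

Lemma superharmonic_laplace_bound (R : realType) (a g : nat -> R) (M : nat)
    (r r' : R) :
  (forall k, 0 < a k)%R ->
  (forall e : R, 0 < e -> exists K0, forall K, \sum_(K0 <= k < K) a k <= e)%R ->
  (forall j, 0 < g j)%R ->
  (forall j K, \sum_(0 <= k < K) a k * g (j + k)%N <= r * g j.+1)%R ->
  (forall K, \sum_(0 <= k < K) a k * g (M + k)%N <= r * g 0%N)%R ->
  (r < r')%R ->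
  exists2 q : R, (q <= 0)%R & forall K, (laplace_psum a q K <= r')%R.
Proof.
move=> a0 atail g0 rg rgM rr'.
have r0 := superharmonic_eigenvalue_gt0 a0 g0 rg.
have [[c c0 cg]|ninf] := pselect (exists2 c : R, (0 < c)%R &
    forall j, (c <= g j)%R).
  exists 0%R => // K; apply: le_trans (ltW rr').
  rewrite /laplace_psum; under eq_bigr do rewrite mul0r expR0 mulr1.
  set A := (\sum_(0 <= k < K) a k)%R.
  have A0 : (0 <= A)%R by apply: sumr_ge0 => k _; exact: ltW.
  have ginf : has_inf (range g).
    by split; [exists (g 0%N), 0%N | exists c => _ [j _ <-]].
  have infg j : (inf (range g) <= g j)%R.
    by apply: ge_inf; [case: ginf|exists j].
  have inf0 : (0 < inf (range g))%R.
    apply: (lt_le_trans c0); apply: lb_le_inf; first by case: ginf.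
    by move=> _ [j _ <-].
  (* Bounding each [g] on the left of a row by the infimum, row 0 through [rgM]; taking the infimum
     over [j] then leaves [A <= r]. *)
  have lb j : (A * inf (range g) / r <= g j)%R.
    rewrite ler_pdivrMr // [leRHS]mulrC /A mulr_suml; case: j => [|j].
      by apply: le_trans (rgM K); apply: ler_sum => k _; rewrite ler_pM2l.
    by apply: le_trans (rg j K); apply: ler_sum => k _; rewrite ler_pM2l.
  have : (A * inf (range g) / r <= inf (range g))%R.
    apply: lb_le_inf; first by case: ginf.
    by move=> _ [j _ <-].
  by rewrite ler_pdivrMr // [leRHS]mulrC ler_pM2r.
(* Otherwise [g] is at least 1 from [N0] on, and the minimum of 1 and the finitely many earlier
   values is a positive lower bound. An index with [g N <= 1] makes [q = ln (g N) / N]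
   nonpositive. *)
have small N0 : exists2 N, (N0 <= N)%N & (g N <= 1)%R.
  apply: contrapT => nN; apply: ninf.
  have H N : (N0 <= N)%N -> (1 <= g N)%R.
    by move=> h; apply/ltW; rewrite ltNge; apply/negP => h'; apply: nN;
      exists N.
  suff [c c0 cg] : exists2 c : R, (0 < c)%R &
      forall j, (j < N0)%N -> (c <= g j)%R.
    exists (Num.min 1 c)%R; first by rewrite lt_min ltr01.
    move=> j; rewrite ge_min.
    by case: (leqP N0 j) => [/H|/cg] ->; rewrite ?orbT.
  elim: {H nN} N0 => [|n [c c0 cg]]; first by exists 1%R.
  exists (Num.min c (g n)); first by rewrite lt_min c0 g0.
  move=> j; rewrite ltnS leq_eqVlt ge_min => /predU1P[->|/cg ->//].
  by rewrite lexx orbT.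
(* Half of the gap pays for the averaging error, the other half for the tail of [a]. *)
pose e := ((r' - r) / 2)%R.
have e0 : (0 < e)%R by rewrite divr_gt0 // subr_gt0.
have [K0 HK0] := atail e e0.
have [D D0 HD] := superharmonic_mean_growth K0.+1 a0 g0 rg.
(* Chosen so that [(r + e) * D < e * (N - D)] for [N > n], which yields
   [r * N <= (r + e) * (N - D)]. *)
have [n Hn] : exists n : nat, ((r + e) * D / e + D < n%:R)%R.
  exists (Num.bound ((r + e) * D / e + D)%R).
  apply: archi_boundP; apply: addr_ge0 => //.
  by rewrite divr_ge0 ?(ltW e0) // mulr_ge0 // addr_ge0 ?(ltW r0) ?(ltW e0).
have [N nN gN1] := small n.+1.
have N0 : (0 < N)%N by apply: leq_trans nN.
have NR : ((r + e) * D / e + D < N%:R)%R.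
  by apply: (lt_le_trans Hn); rewrite ler_nat ltnW.
have hN : ((r + e) * D < e * (N%:R - D))%R.
  by rewrite [ltRHS]mulrC -ltr_pdivrMr // ltrBrDr.
have ND : (0 < N%:R - D)%R.
  rewrite -(pmulr_rgt0 _ e0); apply: le_lt_trans hN.
  by rewrite mulr_ge0 // addr_ge0 ?ltW.
have q0 : (ln (g N) / N%:R <= 0)%R.
  by rewrite pmulr_lle0 ?invr_gt0 ?ltr0n // ln_le0.
exists (ln (g N) / N%:R)%R => // K.
have PK0 : (laplace_psum a (ln (g N) / N%:R) K0.+1 <= r + e)%R.
  rewrite -(ler_pM2l ND); apply: le_trans (HD N N0) _; nra.
have term0 k : (0 <= a k * expR (ln (g N) / N%:R * (k%:R - 1)))%R.
  by rewrite mulr_ge0 ?expR_ge0 // ltW.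
have r'E : (r' = (r + e) + e)%R by rewrite /e; lra.
case: (leqP K K0.+1) => KK0.
  apply: (@le_trans _ _ (r + e)%R); last by lra.
  apply: le_trans PK0.
  rewrite /laplace_psum [leRHS](big_cat_nat (n := K)) //= lerDl.
  by apply: sumr_ge0.
rewrite /laplace_psum (big_cat_nat (n := K0.+1) _ (ltnW KK0)) //= r'E lerD //.
(* Cutting at [K0.+1] rather than [K0] ensures [k >= 1], so that [q * (k - 1) <= 0] and the
   exponential is at most 1. *)
apply: (@le_trans _ _ (\sum_(K0.+1 <= k < K) a k)%R).
  rewrite !big_nat; apply: ler_sum => k /andP[kK _].
  rewrite -[leRHS]mulr1 ler_pM2l // -[leRHS]expR0 ler_expR.
  by apply: (mulr_le0_ge0 q0); rewrite subr_ge0 ler1n (leq_trans _ kK).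
apply: le_trans (HK0 K).
rewrite [leRHS](big_ltn (n:=K)) ?(ltn_trans _ KK0) // lerDr.
exact/ltW.
Qed.

(** * Green function of a nonnegative infinite matrix *)

Lemma imx_pow_ge0 (R : realType) (A : imatrix R) n i j :
  (forall k l, 0 <= A k l) -> 0 <= imx_pow A n i j.
Proof.
move=> A0; elim: n i => [|n IH] i; first by rewrite lee_fin ler0n.
by apply: nneseries_ge0 => k _ _; rewrite mule_ge0.
Qed.

(** Formally the entry [(j, i)] of the inverse of [1 - s A]. The column [i] comes first, so that
    [green A s i] is a vector. *)
Definition green (R : realType) (A : imatrix R) (s : R) (i j : nat) : \bar R :=
  \sum_(0 <= n <oo) ((s ^+ n)%:E * imx_pow A n j i).

(** Applying [s A] to the series shifts it by one power, by Tonelli; only the nonnegative term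
    [n = 0] is lost. *)
Lemma green_superharmonic (R : realType) (A : imatrix R) (s : R) (i j : nat) :
  (0 <= s)%R -> (forall k l, 0 <= A k l) ->
  (forall k l, A k l \is a fin_num) ->
  s%:E * (\sum_(0 <= k <oo) (A j k * green A s i k)) <= green A s i j.
Proof.
move=> s0 A0 Afin; have P0 n k := imx_pow_ge0 n k i A0.
have sn0 n : 0 <= (s ^+ n)%:E by rewrite lee_fin exprn_ge0.
rewrite [leRHS]nneseries_recl //; last by move=> n _; rewrite mule_ge0.
have <- := @nneseries_addn _ (fun n => (s ^+ n)%:E * imx_pow A n j i) 1;
  last by move=> n; rewrite mule_ge0.
rewrite -[leLHS]add0e leeD ?mule_ge0 //.
have -> : \sum_(0 <= k <oo) (A j k * green A s i k) =
    \sum_(0 <= k <oo) \sum_(0 <= n <oo)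
      (A j k * ((s ^+ n)%:E * imx_pow A n k i)).
  apply: eq_eseriesr => k _; rewrite -(fineK (Afin j k)) /green nneseriesZl //.
  by move=> n _; rewrite mule_ge0.
rewrite nneseries_interchange; last by move=> k n; rewrite !mule_ge0.
rewrite -nneseriesZl; last first.
  by move=> n _; apply: nneseries_ge0 => k _ _; rewrite !mule_ge0.
rewrite le_eqVlt; apply/orP; left; apply/eqP; apply: eq_eseriesr => n _.
have -> : \sum_(0 <= k <oo) (A j k * ((s ^+ n)%:E * imx_pow A n k i)) =
    \sum_(0 <= k <oo) ((s ^+ n)%:E * (A j k * imx_pow A n k i)).
  by apply: eq_eseriesr => k _; rewrite muleCA.
rewrite nneseriesZl; last by move=> k _; rewrite mule_ge0.
by rewrite muleA -EFinM -exprS addn1.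
Qed.

(** A single term of the previous sum; it carries finiteness and positivity of the Green function
    between indices joined by a nonzero entry. *)
Lemma green_edge (R : realType) (A : imatrix R) (s : R) (i j k : nat) :
  (0 <= s)%R -> (forall k l, 0 <= A k l) ->
  (forall k l, A k l \is a fin_num) ->
  s%:E * (A j k * green A s i k) <= green A s i j.
Proof.
move=> s0 A0 Afin; have P0 n l := imx_pow_ge0 n l i A0.
have G0 l : 0 <= green A s i l.
  by apply: nneseries_ge0 => n _ _; rewrite mule_ge0 // lee_fin exprn_ge0.
apply: le_trans (green_superharmonic _ _ s0 A0 Afin).
rewrite lee_wpmul2l ?lee_fin //.
rewrite (@nneseriesD1 _ _ k) //; last by move=> l _; rewrite mule_ge0.
by rewrite leeDl // nneseries_ge0 // => l _ _; rewrite mule_ge0.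
Qed.

(** Root test: the diagonal entries are at most [C * x ^ n] for some [x < r], and a geometric series
    dominates. *)
Lemma green_diag_lty (R : realType) (A : imatrix R) (r : R) (i : nat) :
  (forall k l, 0 <= A k l) -> (forall n, imx_pow A n i i \is a fin_num) ->
  (0 < r)%R -> spectral_radius_at A i < r%:E -> green A r^-1 i i < +oo.
Proof.
move=> A0 Pfin r0 /ereal_inf_lt[_ [V [n0 _ n0V] <-] Vr].
have P0 n := imx_pow_ge0 n i i A0.
set u := ereal_sup _ in Vr.
have uub n : (n0 <= n)%N -> imx_pow A n i i `^ (n%:R^-1) <= u.
  by move=> n0n; apply: ereal_sup_ubound; exists n => //; exact: n0V.
have [x x0 xE] : exists2 x : R, (0 < x < r)%R & u <= x%:E.
  have u0 : 0 <= u := le_trans (poweR_ge0 _ _) (uub n0 (leqnn _)).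
  move: u u0 Vr {uub} => [u| |] //; rewrite lee_fin lte_fin => u0 ur.
  by exists ((u + r) / 2)%R; rewrite ?lee_fin; lra.
have [x_gt0 xr] := andP x0.
have Px n : (n0 < n)%N -> imx_pow A n i i <= (x ^+ n)%:E.
  move=> n0n; have n_gt0 : (0 < n)%N by apply: leq_ltn_trans n0n.
  have /= h := le_trans (uub n (ltnW n0n)) xE.
  have := gt0_ler_poweR (ler0n R n) _ _ h.
  rewrite -poweRrM mulVf ?pnatr_eq0 -?lt0n // poweRe1 //.
  rewrite poweR_EFin powR_mulrn ?(ltW x_gt0) //; apply.
    by rewrite in_itv /= poweR_ge0 leey.
  by rewrite in_itv /= lee_fin ltW ?leey.
have [C C0 HC] : exists2 C : R, (0 < C)%R &
    forall n, imx_pow A n i i <= (C * x ^+ n)%:E.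
  suff [C C0 HC] : exists2 C : R, (0 < C)%R &
      forall n, (n <= n0)%N -> imx_pow A n i i <= (C * x ^+ n)%:E.
    exists (Num.max 1%R C); first by rewrite lt_max ltr01.
    move=> n; case: (leqP n n0) => [/HC h|/Px h]; apply: (le_trans h).
      by rewrite lee_fin ler_pM2r ?exprn_gt0 // le_max lexx orbT.
    by rewrite lee_fin ler_peMl ?exprn_ge0 ?(ltW x_gt0) // le_max lexx.
  (* The sum dominates each of the ratios with [n <= n0], which the eventual bound [Px] does not
     cover; the 1 keeps [C] positive. *)
  exists (1 + \sum_(0 <= n < n0.+1) fine (imx_pow A n i i) / x ^+ n)%R.
    rewrite ltr_pwDl // sumr_ge0 // => n _.
    by rewrite divr_ge0 ?fine_ge0 ?exprn_ge0 // ltW.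
  move=> n nn0; rewrite -(fineK (Pfin n)) lee_fin -ler_pdivrMr ?exprn_gt0 //.
  rewrite (bigD1_seq n) ?mem_index_iota ?iota_uniq //= addrCA lerDl.
  rewrite addr_ge0 // sumr_ge0 // => m _.
  by rewrite divr_ge0 ?fine_ge0 ?exprn_ge0 // ltW.
have xr1 : (`|x / r| < 1)%R.
  by rewrite ger0_norm ?divr_ge0 ?ltW // ltr_pdivrMr // mul1r.
apply: (@le_lt_trans _ _ (C / (1 - x / r))%:E); last exact: ltry.
apply: lime_le.
  apply: is_cvg_nneseries => n _ _.
  by rewrite mule_ge0 // lee_fin exprn_ge0 // invr_ge0 ltW.
near=> n.
have := @geometric_le_lim R n C (x / r) (ltW C0) (divr_gt0 x_gt0 r0) xr1.
rewrite -lee_fin; apply: le_trans; rewrite -sumEFin; apply: lee_sum => m _.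
rewrite /= (_ : (C * _)%R = ((r^-1) ^+ m * (C * x ^+ m))%R); last first.
  by rewrite expr_div_n exprVn; ring.
by rewrite EFinM lee_wpmul2l // lee_fin exprn_ge0 // invr_ge0 ltW.
Unshelve. all: by end_near. Qed.

(** * Rows of the Hessenberg matrix *)

(** The column where row [i] starts, with entry [a 0]; it lets row 0 and the other rows be treated
    alike. *)
Definition row_offset (M i : nat) : nat := if i is i'.+1 then i' else M.

Lemma zero_ext_sub (R : realType) (a : nat -> R) (k d : nat) :
  zero_ext a (k%:Z - d%:Z)%R = if (k < d)%N then 0%R else a (k - d)%N.
Proof.
case: ltnP => [kd|dk]; last by rewrite subzn.
rewrite -opprB subzn ?(ltnW kd) //.
by rewrite -(prednK (n := d - k)) ?subn_gt0 // -NegzE.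
Qed.

Lemma hessenbergE (R : realType) (a : nat -> R) (M i k : nat) :
  hessenberg a M i k =
    (if (k < row_offset M i)%N then 0%R else a (k - row_offset M i)%N)%:E.
Proof.
rewrite /hessenberg; case: i => [|i] /=; rewrite -zero_ext_sub //.
by congr (zero_ext a _)%:E; rewrite -[i.+1]addn1 PoszD; ring.
Qed.

Lemma hessenberg_ge0 (R : realType) (a : nat -> R) (M : nat) :
  (forall k, 0 < a k)%R -> forall i k, 0 <= hessenberg a M i k.
Proof.
by move=> a0 i k; rewrite hessenbergE lee_fin; case: ifP => // _; exact: ltW.
Qed.

Lemma hessenberg_row_sum (R : realType) (a : nat -> R) (M i : nat)
    (x : nat -> \bar R) :
  (forall k, 0 < a k)%R -> (forall k, 0 <= x k) ->
  \sum_(0 <= k <oo) (hessenberg a M i k * x k) =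
  \sum_(0 <= k <oo) ((a k)%:E * x (row_offset M i + k)%N).
Proof.
move=> a0 x0; have H0 := hessenberg_ge0 M a0.
rewrite (nneseries_split 0 (row_offset M i)); last first.
  by move=> k _; rewrite mule_ge0.
rewrite big_nat big1 ?add0e ?add0n; last first.
  by move=> k /andP[_ kd]; rewrite hessenbergE kd mul0e.
have <- := @nneseries_addn _ (fun k => hessenberg a M i k * x k)
    (row_offset M i);
  last by move=> k; rewrite mule_ge0.
apply: eq_eseriesr => k _.
by rewrite hessenbergE ltnNge leq_addl /= addnK addnC.
Qed.

Lemma summable_tail_le (R : realType) (a : nat -> R) (e : R) :
  (forall k, 0 <= a k)%R -> \sum_(0 <= k <oo) (a k)%:E < +oo -> (0 < e)%R ->
  exists K0, forall K, (\sum_(K0 <= k < K) a k <= e)%R.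
Proof.
move=> a0 a_l1 e0.
have /fine_cvgP[[n1 _ Hfin] cvg0] := nneseries_tail_cvg a_l1 (fun k _ => a0 k).
have /cvgrPdist_le /(_ e e0)[n2 _ Hle] := cvg0.
exists (maxn n1 n2) => K.
have := Hle (maxn n1 n2) (leq_maxr _ _); rewrite /= sub0r normrN => h.
rewrite -lee_fin -sumEFin.
apply: le_trans (nneseries_lim_ge (P := xpredT) K _) _.
  by move=> k _ _; rewrite lee_fin.
rewrite -[leLHS]fineK; last exact: (Hfin _ (leq_maxl _ _)).
by rewrite lee_fin (le_trans (ler_norm _)).
Qed.

(** * Upper bound for the spectral radius *)

(** Laplace transform, at [- q], of the measure with mass [a k] at [k - 1]. *)
Definition laplace (R : realType) (a : nat -> R) (q : R) : \bar R :=
  \sum_(0 <= k <oo) (a k * expR (q * (k%:R - 1)))%:E.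

Lemma laplace_ge0 (R : realType) (a : nat -> R) (q : R) :
  (forall k, 0 < a k)%R -> 0 <= laplace a q.
Proof.
move=> a0; apply: nneseries_ge0 => k _ _.
by rewrite lee_fin mulr_ge0 ?expR_ge0 ?ltW.
Qed.

Lemma laplace_lty (R : realType) (a : nat -> R) (q : R) :
  (forall k, 0 < a k)%R -> \sum_(0 <= k <oo) (a k)%:E < +oo -> (q <= 0)%R ->
  laplace a q < +oo.
Proof.
move=> a0 a_l1 q0.
apply: (@le_lt_trans _ _ ((expR (- q))%:E * \sum_(0 <= k <oo) (a k)%:E)).
  rewrite -nneseriesZl; last by move=> k _; rewrite lee_fin ltW.
  apply: lee_nneseries => k _.
    by rewrite lee_fin mulr_ge0 ?expR_ge0 ?ltW.
  rewrite -EFinM lee_fin mulrC ler_pM2r // ler_expR mulrBr mulr1.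
  by rewrite gerDr mulr_le0_ge0.
by rewrite lte_mul_pinfty ?lee_fin ?expR_ge0.
Qed.

(* The vector [expR (q * j)] is superharmonic for the eigenvalue [laplace a q]:
   every row but the first gives an equality, and [q <= 0] takes care of the
   first one. *)
Lemma hessenberg_pow_le (R : realType) (a : nat -> R) (M : nat) (q s : R)
    (n i j : nat) :
  (forall k, 0 < a k)%R -> (q <= 0)%R -> laplace a q = s%:E ->
  imx_pow (hessenberg a M) n j i <= (s ^+ n * expR (q * (j%:R - i%:R)))%:E.
Proof.
move=> a0 q0 qs; have H0 := hessenberg_ge0 M a0.
have s0 : (0 <= s)%R by rewrite -lee_fin -qs laplace_ge0.
elim: n j => [|n IH] j.
  rewrite expr0 mul1r lee_fin; have [->|_] := eqVneq j i.
    by rewrite subrr mulr0 expR0.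
  exact: expR_ge0.
apply: (@le_trans _ _ (\sum_(0 <= k <oo) (hessenberg a M j k *
    (s ^+ n * expR (q * (k%:R - i%:R)))%:E))).
  apply: lee_nneseries => k _; first by rewrite mule_ge0 // imx_pow_ge0.
  by rewrite lee_wpmul2l //; exact: IH.
rewrite (hessenberg_row_sum M j
  (x := fun k => (s ^+ n * expR (q * (k%:R - i%:R)))%:E)) //; last first.
  by move=> k; rewrite lee_fin mulr_ge0 ?exprn_ge0 ?expR_ge0.
set d := row_offset M j.
have -> : \sum_(0 <= k <oo) ((a k)%:E *
      (s ^+ n * expR (q * ((d + k)%:R - i%:R)))%:E) =
    (s ^+ n * expR (q * (d.+1%:R - i%:R)))%:E * laplace a q.
  rewrite /laplace -nneseriesZl; last first.
    by move=> k _; rewrite lee_fin mulr_ge0 ?expR_ge0 ?ltW.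
  apply: eq_eseriesr => k _; rewrite -!EFinM; congr (_%:E).
  rewrite (_ : q * ((d + k)%:R - i%:R) =
    q * (d.+1%:R - i%:R) + q * (k%:R - 1))%R ?expRD; first by ring.
  by rewrite natrD -natr1; ring.
rewrite qs -EFinM lee_fin exprSr [leRHS]mulrAC.
rewrite ler_wpM2r // ler_wpM2l ?exprn_ge0 // ler_expR.
by rewrite ler_wnM2l // lerD2r ler_nat /d; case: j {IH d}.
Qed.

Lemma spectral_radius_ge0 (R : realType) (A : imatrix R) (i : nat) :
  0 <= spectral_radius_at A i.
Proof.
apply: le_ereal_inf_tmp => _ [V [n _ nV] <-].
apply: le_trans (poweR_ge0 _ _) _; last apply: ereal_sup_ubound.
by exists n => //; apply: nV => /=.
Qed.

Lemma hessenberg_radius_le_laplace (R : realType) (a : nat -> R) (M i : nat)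
    (q : R) :
  (forall k, 0 < a k)%R -> \sum_(0 <= k <oo) (a k)%:E < +oo -> (q <= 0)%R ->
  spectral_radius_at (hessenberg a M) i <= laplace a q.
Proof.
move=> a0 a_l1 q0; have S0 := laplace_ge0 q a0.
have Sfin : laplace a q \is a fin_num.
  by rewrite ge0_fin_numE // laplace_lty.
have := hessenberg_pow_le M _ i i a0 q0 (esym (fineK Sfin)).
rewrite subrr mulr0 expR0; set s := fine _ => Hs.
have s0 : (0 <= s)%R by rewrite fine_ge0.
have P0 n := imx_pow_ge0 n i i (hessenberg_ge0 M a0).
(* The index [n = 0] is left out: its root is 1, which may exceed [s]. *)
apply: ge_ereal_inf; eexists.
  by exists [set n | (0 < n)%N] => //; exists 1%N.
apply: ge_ereal_sup => _ [n /= n0 <-].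
have nV : (0 <= n%:R^-1 :> R)%R by rewrite invr_ge0.
apply: le_trans (gt0_ler_poweR nV _ _ (Hs n)) _.
- by rewrite in_itv /= P0 leey.
- by rewrite in_itv /= lee_fin mulr1 exprn_ge0 ?leey.
rewrite mulr1 poweR_EFin -powR_mulrn // -powRrM mulfV ?pnatr_eq0 -?lt0n //.
by rewrite powRr1 // fineK.
Qed.

(** * Lower bound and variational formula *)

Lemma laplace_le_of_hessenberg_radius_lt (R : realType) (a : nat -> R)
    (M i : nat) (r : R) :
  (forall k, 0 < a k)%R -> \sum_(0 <= k <oo) (a k)%:E < +oo ->
  spectral_radius_at (hessenberg a M) i < r%:E ->
  exists2 q : R, (q <= 0)%R & laplace a q <= r%:E.
Proof.
move=> a0 a_l1 rho_r; set H := hessenberg a M in rho_r.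
have H0 : forall k l, 0 <= H k l by exact: hessenberg_ge0.
have Hfin k l : H k l \is a fin_num by rewrite /H hessenbergE.
(* The Green function is taken at [1 / t]; the gap between [t] and [r] absorbs the error of the
   averaging argument. *)
have [t [t0 rho_t tr]] : exists t : R,
    [/\ (0 < t)%R, spectral_radius_at H i < t%:E & (t < r)%R].
  have := spectral_radius_ge0 H i.
  case: (spectral_radius_at H i) rho_r => [x| |] //.
  rewrite lte_fin lee_fin => xr x0.
  by exists ((x + r) / 2)%R; rewrite ?lte_fin; split; lra.
have Sfin : laplace a 0 \is a fin_num.
  by rewrite ge0_fin_numE ?laplace_ge0 // laplace_lty.
have Pfin n : imx_pow H n i i \is a fin_num.
  rewrite ge0_fin_numE ?imx_pow_ge0 //.
  have := hessenberg_pow_le M n i i a0 (lexx _) (esym (fineK Sfin)).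
  by move=> /le_lt_trans; apply; exact: ltry.
pose G := green H t^-1 i.
have tV0 : (0 < t^-1)%R by rewrite invr_gt0.
have P0 n j : 0 <= ((t^-1) ^+ n)%:E * imx_pow H n j i.
  by rewrite mule_ge0 ?imx_pow_ge0 // lee_fin exprn_ge0 ?ltW.
have G0 j : 0 <= G j by apply: nneseries_ge0 => n _ _.
have Gi_lty : G i < +oo by exact: green_diag_lty.
have Gi_gt0 : 0 < G i.
  rewrite /G /green (@nneseriesD1 _ _ 0) // expr0 mul1e.
  rewrite /imx_pow /= /imx_id eqxx.
  apply: lte_paddr; last by rewrite lte_fin ltr01.
  by apply: nneseries_ge0 => n _ _; exact: P0.
(* Row [j] reaches every column from its offset on. Finiteness passes from [j] to these columns,
   positivity from them to [j]. *)
have edge j k : t^-1%:E * ((a k)%:E * G (row_offset M j + k)%N) <= G j.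
  have := @green_edge _ H t^-1 i j (row_offset M j + k) (ltW tV0) H0 Hfin.
  by rewrite /H hessenbergE ltnNge leq_addr /= addKn.
have edge_lty j k : G j < +oo -> G (row_offset M j + k)%N < +oo.
  move=> Gj; have := le_lt_trans (edge j k) Gj.
  case: (G (row_offset M j + k)%N) => [x| |] //; rewrite ?ltry //.
  by rewrite !gt0_muley ?lte_fin.
have edge_gt0 j k : 0 < G (row_offset M j + k)%N -> 0 < G j.
  by move=> Gk; apply: lt_le_trans (edge j k); rewrite !mule_gt0 ?lte_fin.
have down_lty j k : G (k + j)%N < +oo -> G j < +oo.
  elim: k => // k IH Gk; apply: IH.
  by have := @edge_lty (k + j).+1 0%N Gk; rewrite addn0.
(* Down from [i] to 0, across row 0 to [M + j], then down to [j]. *)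
have G_lty j : G j < +oo.
  have Gz : G 0%N < +oo by apply: (@down_lty 0%N i); rewrite addn0.
  by apply: (@down_lty j M); exact: (@edge_lty 0%N j).
have up_gt0 j k : 0 < G j -> 0 < G (k + j)%N.
  elim: k => // k IH /IH Gk.
  by apply: (@edge_gt0 _ 0%N); rewrite /= addn0.
(* Up from [i] to [M + i], back to 0 along row 0, then up to [j]. *)
have G_gt0 j : 0 < G j.
  rewrite -[j]addn0; apply: (@up_gt0 0%N); apply: (@edge_gt0 _ i) => /=.
  exact: up_gt0.
have Gfin j : G j \is a fin_num by rewrite ge0_fin_numE.
pose g j := fine (G j).
have row j K : (\sum_(0 <= k < K) a k * g (row_offset M j + k)%N <= t * g j)%R.
  have := @green_superharmonic _ H t^-1 i j (ltW tV0) H0 Hfin.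
  rewrite -/G /H (hessenberg_row_sum _ _ a0 G0) lee_pdivrMl //.
  rewrite -(fineK (Gfin j)) -EFinM => h.
  rewrite -lee_fin -sumEFin; apply: le_trans h.
  apply: le_trans (nneseries_lim_ge K _); last first.
    by move=> k _ _; rewrite mule_ge0 ?lee_fin ?ltW.
  by apply: lee_sum => k _; rewrite EFinM fineK.
have g0 j : (0 < g j)%R by rewrite fine_gt0 // G_gt0 G_lty.
have tail e : (0 < e)%R -> exists K0, forall K, (\sum_(K0 <= k < K) a k <= e)%R.
  by apply: summable_tail_le => // k; exact: ltW.
have [q q0 Hq] := superharmonic_laplace_bound a0 tail g0
  (fun j => row j.+1) (row 0%N) tr.
exists q => //; apply: lime_le.
  by apply: is_cvg_nneseries => k _ _; rewrite lee_fin mulr_ge0 ?expR_ge0 ?ltW.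
by near=> K; rewrite sumEFin lee_fin; exact: Hq.
Unshelve. all: by end_near. Qed.

Lemma lne_hessenberg_radius (R : realType) (a : nat -> R) (M i : nat) :
  (forall k, 0 < a k)%R -> \sum_(0 <= k <oo) (a k)%:E < +oo ->
  lne (spectral_radius_at (hessenberg a M) i) =
  ereal_inf [set lne (laplace a q) | q in [set q : R | (q <= 0)%R]].
Proof.
move=> a0 a_l1; set rho := spectral_radius_at _ _.
have rho0 : 0 <= rho := spectral_radius_ge0 _ _.
have S0 q := laplace_ge0 q a0.
apply/eqP; rewrite eq_le; apply/andP; split.
  apply: le_ereal_inf_tmp => _ [q /= q0 <-].
  by rewrite lee_lne ?in_itv /= ?rho0 ?S0 ?leey // hessenberg_radius_le_laplace.
set L := ereal_inf _.
have LS q : (q <= 0)%R -> expeR L <= laplace a q.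
  move=> q0; rewrite -[leRHS](lneK (x := laplace a q)) ?in_itv /= ?S0 ?leey //.
  by rewrite lee_expeR; apply: ereal_inf_lbound; exists q.
(* If [rho < expeR L], a real [t] strictly between them bounds some [laplace a q] from above,
   although [expeR L] is a lower bound of all of them. *)
rewrite leNgt; apply/negP.
rewrite -lte_expeR lneK ?in_itv /= ?rho0 ?leey // => rhoL.
have Lfin : expeR L \is a fin_num.
  rewrite ge0_fin_numE ?expeR_ge0 //; apply: le_lt_trans (LS 0%R (lexx _)) _.
  exact: laplace_lty.
move: LS rhoL; rewrite -(fineK Lfin); set l := fine _ => LS rhol.
have [t rho_t tl] : exists2 t : R, rho < t%:E & (t < l)%R.
  case: rho rho0 rhol => [x| |] //; rewrite lee_fin lte_fin => x0 xl.
  by exists ((x + l) / 2)%R; rewrite ?lte_fin; lra.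
have [q q0 qt] := laplace_le_of_hessenberg_radius_lt a0 a_l1 rho_t.
by have := le_trans (LS q q0) qt; rewrite lee_fin leNgt tl.
Qed.

(** * Convexity and location of the minimum *)

(* This is the derivative of [laplace a] at [q] times [expR q]. *)
Definition laplace_deriv (R : realType) (a : nat -> R) (q : R) : \bar R :=
  \sum_(0 <= k <oo) ((k%:R - 1) * a k * expR (q * k%:R))%:E.

(** Only the term [k = 0] is negative, so the partial sums are nondecreasing from index 1 on; the
    limit may be [+oo]. *)
Lemma laplace_deriv_cvg (R : realType) (a : nat -> R) (q : R) :
  (forall k, 0 < a k)%R ->
  (\sum_(0 <= k < n) ((k%:R - 1) * a k * expR (q * k%:R))%:E) @[n --> \oo]
    --> laplace_deriv a q.
Proof.
move=> a0; rewrite /laplace_deriv; set u := fun n => (\sum_(0 <= k < n) _)%R.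
suff : cvgn [sequence u n.+1]_n.
  move=> /cvg_ex[l]; rewrite cvg_shiftS => ul.
  by apply: cvgP ul.
apply: ereal_nondecreasing_is_cvgn; apply/nondecreasing_seqP => n /=.
rewrite /u [leRHS]big_nat_recr //= leeDl // lee_fin.
by rewrite !mulr_ge0 ?expR_ge0 ?(ltW (a0 _)) // subr_ge0 ler1n.
Qed.

(** The term [k = 0] is [- a 0] and the others are nonnegative. This rules out the value [-oo]. *)
Lemma laplace_deriv_ge (R : realType) (a : nat -> R) (q : R) :
  (forall k, 0 < a k)%R -> (- a 0%N)%:E <= laplace_deriv a q.
Proof.
move=> a0; apply: lime_ge; first by apply: cvgP; exact: laplace_deriv_cvg.
exists 1%N => // n /= n1; rewrite big_ltn // -[leLHS]adde0; apply: leeD.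
  by rewrite mulr0 expR0 mulr1 sub0r mulN1r.
rewrite big_nat; apply: sume_ge0 => k /andP[k1 _]; rewrite lee_fin.
by rewrite !mulr_ge0 ?expR_ge0 ?(ltW (a0 _)) // subr_ge0 ler1n.
Qed.

Lemma laplace_cvg (R : realType) (a : nat -> R) (q s : R) :
  (forall k, 0 < a k)%R -> laplace a q = s%:E ->
  laplace_psum a q n @[n --> \oo] --> s.
Proof.
move=> a0 qs.
have : (\sum_(0 <= k < n) (a k * expR (q * (k%:R - 1)))%:E) @[n --> \oo]
    --> s%:E.
  rewrite -qs; apply: is_cvg_nneseries => k _ _.
  by rewrite lee_fin mulr_ge0 ?expR_ge0 ?ltW.
move=> /fine_cvg; apply: cvg_trans; apply: near_eq_cvg.
by near=> n => /=; rewrite sumEFin.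
Unshelve. all: by end_near. Qed.

(* Convexity: the graph of [laplace a] lies above its tangent at [q0]. *)
Lemma laplace_tangent (R : realType) (a : nat -> R) (q q0 t : R) :
  (forall k, 0 < a k)%R -> \sum_(0 <= k <oo) (a k)%:E < +oo ->
  (q <= 0)%R -> (q0 <= 0)%R ->
  laplace_deriv a q0 = t%:E -> (0 <= (q - q0) * t)%R ->
  laplace a q0 <= laplace a q.
Proof.
move=> a0 a_l1 q_le0 q0_le0 tE qt.
have Sfin p : (p <= 0)%R -> laplace a p = (fine (laplace a p))%:E.
  by move=> p0; rewrite fineK // ge0_fin_numE ?laplace_ge0 // laplace_lty.
have cq := laplace_cvg a0 (Sfin q q_le0).
have cq0 := laplace_cvg a0 (Sfin q0 q0_le0).
have ct : (\sum_(0 <= k < n) ((k%:R - 1) * a k * expR (q0 * k%:R)))%R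
    @[n --> \oo] --> t.
  have := @laplace_deriv_cvg _ a q0 a0; rewrite tE => /fine_cvg.
  by apply: cvg_trans; apply: near_eq_cvg; near=> n => /=; rewrite sumEFin.
rewrite (Sfin q) // (Sfin q0) // lee_fin.
(* The factor [expR (- q0)] turns [t] into the slope of the tangent at [q0]. *)
apply: (@le_trans _ _ (fine (laplace a q0) + (q - q0) * expR (- q0) * t)%R).
  by rewrite lerDl mulrAC mulr_ge0 ?expR_ge0.
pose c := ((q - q0) * expR (- q0))%R.
have cc : (laplace_psum a q0 n + c *
      \sum_(0 <= k < n) ((k%:R - 1) * a k * expR (q0 * k%:R)))%R @[n --> \oo]
    --> (fine (laplace a q0) + c * t)%R.
  by apply: cvgD; [exact: cq0|apply: cvgMl_tmp; exact: ct].
apply: (ler_cvg_to cc cq).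
near=> n; rewrite /laplace_psum /c /= mulr_sumr -big_split /=.
apply: ler_sum => k _.
have -> : (q * (k%:R - 1) = q0 * (k%:R - 1) + (q - q0) * (k%:R - 1))%R by ring.
have -> : (q0 * k%:R = q0 * (k%:R - 1) + q0)%R by ring.
rewrite !expRD expRN.
(* The tangent inequality is obtained term by term on partial sums, so the series is never
   differentiated. *)
have := expR_ge1Dx ((q - q0) * (k%:R - 1))%R.
rewrite -(ler_pM2l (mulr_gt0 (a0 k) (expR_gt0 (q0 * (k%:R - 1))%R))).
rewrite -[leRHS]mulrA; apply: le_trans.
rewrite le_eqVlt; apply/orP; left; apply/eqP; field.
by rewrite gt_eqF ?expR_gt0.
Unshelve. all: by end_near. Qed.

Lemma lne_hessenberg_radius_min (R : realType) (a : nat -> R) (M i : nat)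
    (q0 : R) :
  (forall k, 0 < a k)%R -> \sum_(0 <= k <oo) (a k)%:E < +oo -> (q0 <= 0)%R ->
  (forall q, (q <= 0)%R -> laplace a q0 <= laplace a q) ->
  lne (spectral_radius_at (hessenberg a M) i) = lne (laplace a q0).
Proof.
move=> a0 a_l1 q0_le0 min_q0; rewrite lne_hessenberg_radius //.
apply/eqP; rewrite eq_le; apply/andP; split.
  by apply: ereal_inf_lbound; exists q0.
apply: le_ereal_inf_tmp => _ [q /= q_le0 <-].
by rewrite lee_lne ?in_itv /= ?laplace_ge0 ?leey // min_q0.
Qed.

Theorem mainTheorem7 (R : realType) (a : nat -> R) (M : nat)
    (a_pos : forall k : nat, (0 < a k)%R)
    (a_l1 : \sum_(0 <= k <oo) `|a k|%:E < +oo)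
    (i : nat) :
  let rho := spectral_radius_at (hessenberg a M) i in
  let S := fun q : R =>
    \sum_(0 <= k <oo) (a k * expR (q * (k%:R - 1)))%:E in
  let T := fun q : R =>
    \sum_(0 <= k <oo) ((k%:R - 1) * a k * expR (q * k%:R))%:E in
  [/\ lne rho = ereal_inf [set lne (S q) | q in [set q : R | (q <= 0)%R]],
      (forall q : R, (q <= 0)%R -> T q < 0) ->
        lne rho = lne (\sum_(0 <= k <oo) (a k)%:E)
    & forall q0 : R,
        unique (fun q : R => (q < 0)%R /\ T q = 0) q0 ->
        lne rho = lne (S q0)].
Proof.
have {}a_l1 : \sum_(0 <= k <oo) (a k)%:E < +oo.
  rewrite (eq_eseriesr (g := fun k => `|a k|%:E)) // => k _.
  by rewrite ger0_norm // ltW.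
move=> rho S T; split.
- exact: lne_hessenberg_radius.
- move=> T_lt0.
  have -> : \sum_(0 <= k <oo) (a k)%:E = laplace a 0.
    by apply: eq_eseriesr => k _; rewrite mul0r expR0 mulr1.
  apply: lne_hessenberg_radius_min => // q q_le0.
  have := T_lt0 0%R (lexx _); have := laplace_deriv_ge 0 a_pos.
  rewrite /T -/(laplace_deriv a 0).
  (* The value is real and negative: [laplace a] has negative slope at 0, so by convexity its
     minimum over [q <= 0] is at 0. *)
  case E : (laplace_deriv a 0) => [t| |] // _; rewrite lte_fin => t0.
  apply: (laplace_tangent a_pos a_l1 q_le0 (lexx _) E).
  by rewrite subr0 mulr_le0 // ltW.
- move=> q0 [[q0_lt0 Tq0] _].
  (* The tangent at [q0] is horizontal, so [q0] is a minimum. *)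
  apply: lne_hessenberg_radius_min => // [|q q_le0]; first exact: ltW.
  by apply: (laplace_tangent a_pos a_l1 q_le0 (ltW q0_lt0) Tq0); rewrite mulr0.
Qed.
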